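(* Let $(X,\mathcal{U})$ be a quasi-uniform space such that $(X,\le_{\mathcal{U}})$ is a complete lattice. Suppose the multivalued map $T\colon X\to 2^X$ has a selector $f\colon X\to X$ that is $\le_{\mathcal{U}}$-monotone, in the sense that $x\le_{\mathcal{U}}y$ implies $f(x)\le_{\mathcal{U}}f(y)$. Then the set $$\mathrm{Pre}(f):=\{x\in X: x\le_{\mathcal{U}}f(x)\}$$ is contained in $\mathrm{Start}(T)$ and has a $\le_{\mathcal{U}}$-greatest element $\bar x$, given by $\bar x=\bigvee\{x\in X:x\le_{\mathcal{U}}f(x)\}$; moreover $\bar x$ satisfies $\bar x\equiv_{\mathcal{U}}f(\bar x)$, so it is a $\mathcal{U}$-startpoint of $T$ witnessed by $f(\bar x)$. When $\mathcal{U}$ is $T_0$, $\bar x$ is moreover a fixed point of $f$ in the ordinary sense, $\bar x=f(\bar x)$.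
   Context: $X$ is a non-empty set. A quasi-uniformity on $X$ is a filter $\mathcal{U}$ on $X\times X$ such that every $U\in\mathcal{U}$ contains the diagonal $\Delta_X$ and for every $U\in\mathcal{U}$ there is $V\in\mathcal{U}$ with $V\circ V\subseteq U$, where $V\circ V=\{(x,z):\exists y,\ (x,y)\in V,\ (y,z)\in V\}$. The relation $x\le_{\mathcal{U}}y\iff(x,y)\in\bigcap\mathcal{U}:=\bigcap_{U\in\mathcal{U}}U$ is a preorder on $X$; $\mathcal{U}$ is $T_0$ if it is antisymmetric. Write $x\equiv_{\mathcal{U}}y$ if $x\le_{\mathcal{U}}y$ and $y\le_{\mathcal{U}}x$. Since $\le_{\mathcal{U}}$ is in general only a preorder, ''complete lattice'' is read in the preorder sense: every subset of $X$ has a least upper bound $\bigvee$ and a greatest lower bound $\bigwedge$ with respect to $\le_{\mathcal{U}}$ (each determined up to $\equiv_{\mathcal{U}}$). A selector of $T\colon X\to 2^X$ is a map $f\colon X\to X$ with $f(x)\in Tx$ for every $x\in X$. A point $x$ is a $\mathcal{U}$-startpoint of $T$ witnessed by $z$ if $z\in Tx$ and $(x,z)\in\bigcap\mathcal{U}$; $\mathrm{Start}(T)$ is the set of all $\mathcal{U}$-startpoints of $T$. *)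

(* Defs.v *)
From mathcomp Require Import all_boot.
From mathcomp Require Export boolp classical_sets filter.

Set Implicit Arguments.
Unset Strict Implicit.
Unset Printing Implicit Defensive.

Local Open Scope classical_set_scope.

(* Properness of the filter is not a field: it follows from
   [quasi_uniform_refl] when [X] is non-empty. *)
Record quasi_uniformity (X : Type) (U : set_system (X * X)) : Prop := {
  quasi_uniform_filter : Filter U;
  quasi_uniform_refl : forall A, U A -> diagonal `<=` A;
  quasi_uniform_split : forall A, U A -> exists2 V, U V & (V \; V)%relation `<=` A
}.

Section PreorderOfQuasiUniformity.
Variables (X : Type) (U : set_system (X * X)).

Definition qu_le (x y : X) : Prop := (\bigcap_(A in U) A) (x, y).

Definition qu_equiv (x y : X) : Prop := qu_le x y /\ qu_le y x.

Definition qu_T0 : Prop := forall x y, qu_le x y -> qu_le y x -> x = y.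

End PreorderOfQuasiUniformity.

(* The library's [ubound], [isLub], ... require a [porderType], hence
   antisymmetry; here [le] is only a preorder, so bounds are not unique. *)
Section BoundsForRelation.
Variables (X : Type) (le : X -> X -> Prop).

Definition is_ub (A : set X) (m : X) : Prop := forall x, A x -> le x m.

Definition is_lb (A : set X) (m : X) : Prop := forall x, A x -> le m x.

Definition is_lub (A : set X) (m : X) : Prop :=
  is_ub A m /\ forall b, is_ub A b -> le m b.

Definition is_glb (A : set X) (m : X) : Prop :=
  is_lb A m /\ forall b, is_lb A b -> le b m.

Definition is_greatest (A : set X) (m : X) : Prop := A m /\ is_ub A m.

Definition complete_lattice : Prop :=
  forall A : set X, (exists m, is_lub A m) /\ (exists m, is_glb A m).

Definition le_monotone (f : X -> X) : Prop :=
  forall x y, le x y -> le (f x) (f y).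

End BoundsForRelation.

Definition selector (X : Type) (T : X -> set X) (f : X -> X) : Prop :=
  forall x, T x (f x).

Section Startpoints.
Variables (X : Type) (U : set_system (X * X)).

Definition startpoint_witnessed (T : X -> set X) (x z : X) : Prop :=
  T x z /\ (\bigcap_(A in U) A) (x, z).

Definition Start (T : X -> set X) : set X :=
  [set x | exists z, startpoint_witnessed T x z].

Definition Pre (f : X -> X) : set X := [set x | qu_le U x (f x)].

End Startpoints.

(* Main.v *)
(* The Knaster-Tarski argument: each point x of Pre(f) satisfies
   x <= f(x) <= f(xbar), so f(xbar) is an upper bound of Pre(f) and
   xbar <= f(xbar).  By monotonicity f(xbar) is again in Pre(f), whence
   f(xbar) <= xbar. *)
Require Import Defs.
From mathcomp Require Import all_boot.

Local Open Scope classical_set_scope.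

(** Every entourage [A] contains some [V \; V]; both given pairs lie in [V], with [y] as the middle
    point. *)
Lemma qu_le_trans (X : Type) (U : set_system (X * X)) :
  quasi_uniformity U ->
  forall x y z, qu_le U x y -> qu_le U y z -> qu_le U x z.
Proof.
move=> Uqu x y z xy yz A UA.
have [V UV VVA] := quasi_uniform_split Uqu UA.
by apply: VVA; exists y; [exact: xy | exact: yz].
Qed.

Lemma lub_postfixed_equiv (X : Type) (le : X -> X -> Prop) (f : X -> X) m :
  (forall x y z, le x y -> le y z -> le x z) -> le_monotone le f ->
  is_lub le [set x | le x (f x)] m -> le m (f m) /\ le (f m) m.
Proof.
move=> le_trans f_mono [m_ub m_least].
have m_fm : le m (f m).
  by apply: m_least => x x_fx; exact: le_trans x_fx (f_mono _ _ (m_ub _ x_fx)).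
by split=> //; apply: m_ub; apply: f_mono.
Qed.

Theorem proposition6p11 (X : Type) (X_nonempty : inhabited X)
    (U : set_system (X * X)) (U_qu : quasi_uniformity U)
    (U_complete : complete_lattice (qu_le U))
    (T : X -> set X) (f : X -> X)
    (f_sel : selector T f) (f_mono : le_monotone (qu_le U) f) :
  Pre U f `<=` Start U T /\
  (exists xbar, is_greatest (qu_le U) (Pre U f) xbar) /\
  (forall xbar, is_lub (qu_le U) (Pre U f) xbar ->
     is_greatest (qu_le U) (Pre U f) xbar /\
     qu_equiv U xbar (f xbar) /\
     startpoint_witnessed U T xbar (f xbar) /\
     (qu_T0 U -> xbar = f xbar)).
Proof.
(* Joins are determined only up to [qu_equiv], so [m] is an arbitrary one; this serves both the
   existence claim and the universal one. *)
have equiv m : is_lub (qu_le U) (Pre U f) m -> qu_equiv U m (f m).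
  by apply: lub_postfixed_equiv => //; exact: qu_le_trans.
split; first by move=> x x_fx; exists (f x); split; [exact: f_sel | exact: x_fx].
split.
  have [[m m_lub] _] := U_complete (Pre U f).
  (* The half [m <= f m] of [equiv] puts the join inside [Pre U f], which makes it the greatest
     element. *)
  by exists m; split; [case: (equiv m m_lub) | case: m_lub].
move=> m m_lub; have [m_fm fm_m] := equiv m m_lub.
split; first by split=> //; case: m_lub.
split; first by [].
split; first by split; [exact: f_sel | exact: m_fm].
by move=> T0; exact: T0.
Qed.
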